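(* Let $\mathbb{T}$ be a time scale, $a,b\in\mathbb{T}$ with $a<b$, $I=[a,b]_{\mathbb{T}}$, let $g:I\to\mathbb{R}$ be strictly increasing, and let $\Box\in\{\Delta,\nabla\}$. Let $f_1$ and $f_2$ be Riemann-Stieltjes $\Box$-integrable on $I$ with respect to $g$, and let $c\in\mathbb{R}$ be a constant. Then: (i) $cf_1\in\mathcal{R}_{\Box}(g,I)$ and $\int_a^b cf_1\,\Box g=c\int_a^b f_1\,\Box g$; (ii) $f_1+f_2\in\mathcal{R}_{\Box}(g,I)$ and $\int_a^b (f_1+f_2)\,\Box g=\int_a^b f_1\,\Box g+\int_a^b f_2\,\Box g$.
   Context: A time scale $\mathbb{T}$ is a nonempty closed subset of $\mathbb{R}$. The jump operators are $\sigma(t)=\inf\{s\in\mathbb{T}: s>t\}$ and $\rho(t)=\sup\{s\in\mathbb{T}: s<t\}$ (with $\sigma(\max\mathbb{T})=\max\mathbb{T}$, $\rho(\min\mathbb{T})=\min\mathbb{T}$ when these exist). For $a<b$ in $\mathbb{T}$: $[a,b]_{\mathbb{T}}=[a,b]\cap\mathbb{T}$, $[a,b]_{\Delta}=[a,\rho(b)]_{\mathbb{T}}$, $[a,b]_{\nabla}=[\sigma(a),b]_{\mathbb{T}}$. The symbol $\Box$ stands for $\Delta$ or $\nabla$, the same choice throughout. $\mathcal{P}(I)$ is the set of partitions of $I=[a,b]_{\mathbb{T}}$, i.e. finite sets $P=\{t_0,\ldots,t_n\}\subset I$ with $a=t_0<\cdots<t_n=b$. For $f:I\to\mathbb{R}$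 bounded and $P\in\mathcal{P}(I)$ put $\Delta g_j=g(t_j)-g(t_{j-1})$, $I_{\Box j}=[t_{j-1},t_j]_{\Box}$, $m_{\Box j}=\inf_{I_{\Box j}}f$, $M_{\Box j}=\sup_{I_{\Box j}}f$, and $$U_{\Box}(P,f,g)=\sum_{j=1}^n M_{\Box j}\Delta g_j,\qquad L_{\Box}(P,f,g)=\sum_{j=1}^n m_{\Box j}\Delta g_j .$$ The upper and lower Darboux-Stieltjes $\Box$-integrals are $\overline{\int_a^b}f\,\Box g=\inf_{P\in\mathcal{P}(I)}U_{\Box}(P,f,g)$ and $\underline{\int_a^b}f\,\Box g=\sup_{P\in\mathcal{P}(I)}L_{\Box}(P,f,g)$. If they are equal, $f$ is called Riemann-Stieltjes $\Box$-integrable with respect to $g$ on $I$, the common value is denoted $\int_a^b f\,\Box g$, and $\mathcal{R}_{\Box}(g,I)$ is the set of all such (bounded) $f$. *)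

(* Defs.v *)
From HB Require Import structures.
From mathcomp Require Import all_boot all_order all_algebra.
From mathcomp Require Import all_classical all_reals all_analysis.

Set Implicit Arguments.
Unset Strict Implicit.
Unset Printing Implicit Defensive.

Import Order.TTheory GRing.Theory Num.Theory numFieldNormedType.Exports.

Local Open Scope classical_set_scope.
Local Open Scope ring_scope.

Definition time_scale (R : realType) (T : set R) : Prop :=
  T !=set0 /\ closed T.

(* The conditionals implement sigma (max T) = max T and rho (min T) = min T:
   for t in T the set below is empty exactly when t is that extremum. *)
Definition sigma (R : realType) (T : set R) (t : R) : R :=
  if `[< [set s | T s /\ t < s] !=set0 >] then inf [set s | T s /\ t < s]
  else t.

Definition rho (R : realType) (T : set R) (t : R) : R :=
  if `[< [set s | T s /\ s < t] !=set0 >] then sup [set s | T s /\ s < t]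
  else t.

Definition ts_itv (R : realType) (T : set R) (a b : R) : set R :=
  `[a, b] `&` T.

Inductive box_kind : Type := Delta | Nabla.

Definition box_itv (R : realType) (k : box_kind) (T : set R) (a b : R) :
    set R :=
  match k with
  | Delta => ts_itv T a (rho T b)
  | Nabla => ts_itv T (sigma T a) b
  end.

(* s = [:: t_1; ...; t_n] encodes the partition {t_0 < t_1 < ... < t_n} with
   t_0 = a left implicit, as in itv_partition. *)
Definition ts_partition (R : realType) (T : set R) (a b : R) (s : seq R) :
    Prop :=
  itv_partition a b s /\ [set` a :: s] `<=` ts_itv T a b.

Section darboux_stieltjes.
Context {R : realType}.
Variables (k : box_kind) (T : set R) (a b : R) (g f : R -> R).

Definition darboux_upper (s : seq R) : R :=
  let t := nth b (a :: s) in
  \sum_(0 <= j < size s)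
    sup (f @` box_itv k T (t j) (t j.+1)) * (g (t j.+1) - g (t j)).

Definition darboux_lower (s : seq R) : R :=
  let t := nth b (a :: s) in
  \sum_(0 <= j < size s)
    inf (f @` box_itv k T (t j) (t j.+1)) * (g (t j.+1) - g (t j)).

Definition upper_integral : R := inf (darboux_upper @` ts_partition T a b).

Definition lower_integral : R := sup (darboux_lower @` ts_partition T a b).

(* sup and inf are total on set R, with junk value 0 on unbounded sets; the
   boundedness clause keeps them genuine. *)
Definition RS_integrable : Prop :=
  [bounded f x | x in ts_itv T a b] /\ upper_integral = lower_integral.

(* Meaningful under RS_integrable, where it is the common value. *)
Definition RS_integral : R := upper_integral.

End darboux_stieltjes.

(* Functions on I = [a,b]_T are represented by total functions R -> R, of which
   only the values on I are used. *)
Definition RS_class (R : realType) (k : box_kind) (T : set R) (a b : R)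
    (g : R -> R) : set (R -> R) :=
  [set f | RS_integrable k T a b g f].

(* Main.v *)
Require Import Defs.
From HB Require Import structures.
From mathcomp Require Import all_boot all_order all_algebra.
From mathcomp Require Import all_classical all_reals all_analysis.
From mathcomp Require Import lra.
Import Order.TTheory GRing.Theory Num.Theory numFieldNormedType.Exports.
Local Open Scope classical_set_scope.
Local Open Scope ring_scope.

Set Implicit Arguments.
Unset Strict Implicit.

(** The upper integral, as a functional [f |-> upper f] on bounded functions, is
sublinear: [upper (f1 + f2) <= upper f1 + upper f2]
([upper_integralD]) and [upper (c f) = c * upper f] for [0 <= c]
([upper_integralZ]). Since inf is sup up to sign, the lower integral of [f] is
[- upper (- f)] ([lower_integralN]), so integrability of [f] says that [upper]
is odd at [f] ([RS_integrableP]). A sublinear functional is linear on the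
functions at which it is odd, and these form a vector space; for the sum, the
chain
  [0 = upper (F - F) <= upper F + upper (- F)
     <= (upper f1 + upper f2) + (- upper f1 - upper f2) = 0]
with [F = f1 + f2] forces equality everywhere. In particular
[0 <= upper f + upper (- f)], which says that lower integrals are at most
upper ones, is a consequence of sublinearity.

Homogeneity is inherited from suprema of sets, through the upper sums.
Subadditivity holds for upper sums over a single partition; to compare sums of
[f1] and [f2] over different partitions one passes to a common refinement
([ts_partition_refinement]), which decreases upper sums because [g] is
increasing ([darboux_upper_refine]). The time scale enters only through
three facts about the cells [box_itv k T u v] with [u < v] in [T]: they are
nonempty, lie in [[u, v]], and grow with [[u, v]]; the two choices of the box
are on the same footing. *)

(** * Suprema, infima and boundedness *)

Lemma supZ (R : realType) (A : set R) (c : R) :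
  0 <= c -> has_sup A -> sup [set c * x | x in A] = c * sup A.
Proof.
move=> c0 [[x Ax] uA]; apply/eqP; rewrite eq_le; apply/andP; split.
  apply: ge_sup => [|_ [y Ay <-]]; first by exists (c * x), x.
  by rewrite ler_wpM2l// ub_le_sup.
(* For [c = 0] the scaled set is [{0}], as [A] is nonempty. *)
have [->|cn0] := eqVneq c 0.
  rewrite mul0r; apply: ub_le_sup; last by exists x; rewrite ?mul0r.
  by exists 0 => _ [y _ <-]; rewrite mul0r.
have cp : 0 < c by rewrite lt_def cn0.
rewrite -ler_pdivlMl//; apply: ge_sup => [|y Ay]; first by exists x.
rewrite ler_pdivlMl//; apply: ub_le_sup; last by exists y.
by case: uA => M uM; exists (c * M) => _ [z Az <-]; rewrite ler_wpM2l// uM.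
Qed.

Lemma infZ (R : realType) (A : set R) (c : R) :
  0 <= c -> has_inf A -> inf [set c * x | x in A] = c * inf A.
Proof.
move=> c0 /has_inf_supN hA; rewrite /inf mulrN -supZ// !image_comp.
by congr (- sup _); apply: eq_imagel => x _ /=; rewrite mulrN.
Qed.

Lemma bounded_onP (R : realType) (f : R -> R) (A : set R) :
  [bounded f x | x in A] <-> exists M, forall x, A x -> `|f x| <= M.
Proof.
split=> [[M [_ h]]|[M h]].
  by exists (M + 1) => x Ax; apply: (h (M + 1)); rewrite // ltrDl.
exists M; split; first exact: num_real.
by move=> N /ltW MN x Ax; exact: le_trans (h _ Ax) MN.
Qed.

Lemma bounded_onD (R : realType) (f1 f2 : R -> R) (A : set R) :
  [bounded f1 x | x in A] -> [bounded f2 x | x in A] ->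
  [bounded f1 x + f2 x | x in A].
Proof.
move=> /bounded_onP[M1 h1] /bounded_onP[M2 h2].
apply/bounded_onP; exists (M1 + M2) => x xA.
by apply: le_trans (ler_normD _ _) _; apply: lerD; [exact: h1|exact: h2].
Qed.

Lemma bounded_onZ (R : realType) (c : R) (f : R -> R) (A : set R) :
  [bounded f x | x in A] -> [bounded c * f x | x in A].
Proof.
move=> /bounded_onP[M h]; apply/bounded_onP; exists (`|c| * M) => x /h.
by rewrite normrM => /ler_wpM2l; exact.
Qed.

(** * Cells of a time scale *)

Lemma rho_itv (R : realType) (T : set R) (u v : R) :
  T u -> u < v -> u <= rho T v <= v.
Proof.
move=> Tu uv; rewrite /rho; case: asboolP => [ne|[]]; last by exists u.
have ub : ubound [set s | T s /\ s < v] v by move=> s [_ /ltW].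
by rewrite ge_sup// andbT ub_le_sup//; exists v.
Qed.

Lemma sigma_itv (R : realType) (T : set R) (u v : R) :
  T v -> u < v -> u <= sigma T u <= v.
Proof.
move=> Tv uv; rewrite /sigma; case: asboolP => [ne|[]]; last by exists v.
have lb : lbound [set s | T s /\ u < s] u by move=> s [_ /ltW].
by rewrite lb_le_inf//= ge_inf//; exists u.
Qed.

Lemma le_rho (R : realType) (T : set R) (u v w : R) :
  T u -> u < v -> v <= w -> rho T v <= rho T w.
Proof.
move=> Tu uv vw; rewrite {1}/rho; case: asboolP => [ne|[]]; last by exists u.
apply: ge_sup => // s [Ts sv].
by have /andP[] := rho_itv Ts (lt_le_trans sv vw).
Qed.

Lemma le_sigma (R : realType) (T : set R) (u v w : R) :
  T w -> v < w -> u <= v -> sigma T u <= sigma T v.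
Proof.
move=> Tw vw uv; rewrite {2}/sigma; case: asboolP => [ne|[]]; last by exists w.
apply: lb_le_inf => // s [Ts vs].
by have /andP[] := sigma_itv Ts (le_lt_trans uv vs).
Qed.

Lemma subset_ts_itv (R : realType) (T : set R) (u v u' v' : R) :
  u' <= u -> v <= v' -> ts_itv T u v `<=` ts_itv T u' v'.
Proof.
move=> uu vv x [/=]; rewrite !in_itv/= => /andP[ux xv] Tx; split => //=.
by rewrite in_itv/= (le_trans uu)// (le_trans xv).
Qed.

(** The cell keeps the endpoint that the box does not cut off: [u] for Delta,
[v] for Nabla. *)
Lemma box_itv_neq0 (R : realType) (T : set R) k (u v : R) :
  T u -> T v -> u < v -> box_itv k T u v !=set0.
Proof.
move=> Tu Tv uv; case: k.
- exists u; split => //=; rewrite in_itv/= lexx.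
  by have /andP[] := rho_itv Tu uv.
- exists v; split => //=; rewrite in_itv/= lexx andbT.
  by have /andP[] := sigma_itv Tv uv.
Qed.

(** This is why refining a partition decreases the suprema: [rho] and [sigma] are
nondecreasing, so the cell of a subinterval lies in the cell of the interval. *)
Lemma subset_box_itv (R : realType) (T : set R) k (u v u' v' : R) :
  T u -> T v -> u' <= u -> u < v -> v <= v' ->
  box_itv k T u v `<=` box_itv k T u' v'.
Proof.
move=> Tu Tv uu uv vv; case: k; apply: subset_ts_itv => //.
- exact: le_rho uv vv.
- exact: le_sigma uv uu.
Qed.

Lemma box_itv_sub (R : realType) (T : set R) k (u v : R) :
  T u -> T v -> u < v -> box_itv k T u v `<=` ts_itv T u v.
Proof.
move=> Tu Tv uv; case: k; apply: subset_ts_itv => //.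
- by have /andP[] := rho_itv Tu uv.
- by have /andP[] := sigma_itv Tv uv.
Qed.

(** * Partitions *)

Lemma ts_partition_cons (R : realType) (T : set R) (a b x : R) s :
  ts_partition T a b (x :: s) -> ts_partition T x b s.
Proof.
move=> [ps ss]; have qs := itv_partition_cons ps; split => // y /= ys.
have [] := ss y; first by rewrite /= inE orbC ys.
move=> /=; rewrite !in_itv/= => /andP[_ yb] Ty; split => //=.
rewrite in_itv/= yb andbT; case: qs => /(order_path_min lt_trans)/allP px _.
by move: ys; rewrite inE => /predU1P[->//|/px/ltW].
Qed.

Lemma ts_partition_cell (R : realType) (T : set R) (a b : R) s j :
  ts_partition T a b s -> (j < size s)%N ->
  let t := nth b (a :: s) in
  [/\ ts_itv T a b (t j), ts_itv T a b (t j.+1) & t j < t j.+1].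
Proof.
move=> [[ps _] ss] js t; split.
- by apply/ss/mem_nth; rewrite /= ltnS ltnW.
- by apply/ss/mem_nth; rewrite /= ltnS.
- by move/pathP : ps; apply.
Qed.

Lemma ts_partition1 (R : realType) (T : set R) (a b : R) :
  T a -> T b -> a < b -> ts_partition T a b [:: b].
Proof.
move=> Ta Tb ab; split; first exact: itv_partition1.
move=> x /=; rewrite !inE => /orP[]/eqP->; split => //=;
  by rewrite in_itv/= lexx ltW.
Qed.

(** The witness is the sorted union of the points. A strictly sorted sequence is
determined by its elements, so each [si] is a filtering of it. *)
Lemma ts_partition_refinement (R : realType) (T : set R) (a b : R) s1 s2 :
  a < b -> ts_partition T a b s1 -> ts_partition T a b s2 ->
  exists s, [/\ ts_partition T a b s, subseq s1 s & subseq s2 s].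
Proof.
move=> ab p1 p2; pose s := sort <=%R (undup (s1 ++ s2)).
have ms x : (x \in s) = (x \in s1) || (x \in s2).
  by rewrite mem_sort mem_undup mem_cat.
have srt : sorted <%R s by rewrite sort_lt_sorted undup_uniq.
have sub s' : ts_partition T a b s' -> {subset s' <= s} -> subseq s' s.
  move=> [[ps' _] _] s's; suff -> : s' = [seq x <- s | x \in s'] by exact: filter_subseq.
  apply: (irr_sorted_eq lt_trans ltxx); first exact: path_sorted ps'.
  - exact: sorted_filter lt_trans _ _ srt.
  - by move=> x; rewrite mem_filter; apply/idP/andP => [h|[]//]; split=> //; exact: s's.
have pts x : x \in s -> a < x /\ ts_itv T a b x.
  have gen s' : ts_partition T a b s' -> x \in s' -> a < x /\ ts_itv T a b x.
    move=> [[/(order_path_min lt_trans)/allP ps' _] ss'] xs'; split; first exact: ps'.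
    by apply: ss'; rewrite /= inE xs' orbT.
  by rewrite ms => /orP[]; exact: gen.
have ps : path <%R a s.
  by rewrite (path_sortedE lt_trans) srt andbT; apply/allP => x /pts[].
exists s; split; [|by apply: sub => // x; rewrite ms => ->|
                   by apply: sub => // x; rewrite ms orbC => ->].
(* [s1] is nonempty because [a < b], so its last point [b] is in [s]. *)
have bs : b \in s.
  rewrite ms; case: p1 => [[_ /eqP lb] _]; case: s1 lb {s ms srt sub pts ps} => /= [lb|y s1 <-].
    by rewrite lb ltxx in ab.
  by rewrite mem_last.
split; last first.
  move=> x /=; rewrite inE => /predU1P[->|/pts[]//].
  by case: p1 => _; apply; rewrite /= mem_head.
(* Nothing follows [b] in [s], since all the points are at most [b]. *)
split => //; move: ps pts; case/splitPr: bs => l [|y r].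
  by rewrite last_cat.
rewrite cat_path/= => /and4P[_ _ yb _] /(_ y).
rewrite mem_cat !inE eqxx !orbT => /(_ isT)[_ [/=]].
by rewrite in_itv/= (leNgt y) yb andbF.
Qed.

(** * Upper sums and refinement *)

Section upper.
Context {R : realType} (T : set R) (k : box_kind) (b : R) (g : R -> R).

Lemma has_sup_box a (f : R -> R) u v : [bounded f x | x in ts_itv T a b] ->
  ts_itv T a b u -> ts_itv T a b v -> u < v -> has_sup (f @` box_itv k T u v).
Proof.
move=> /bounded_onP[M fM] [/= uI Tu] [/= vI Tv] uv; split.
  by have [x ux] := box_itv_neq0 k Tu Tv uv; exists (f x), x.
exists M => _ [x /(box_itv_sub Tu Tv uv) xI <-].
apply: le_trans (ler_norm _) (fM _ _); apply: subset_ts_itv xI.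
- by move: uI; rewrite in_itv/= => /andP[].
- by move: vI; rewrite in_itv/= => /andP[].
Qed.

Lemma darboux_lowerN a f s :
  darboux_lower k T a b g f s = - darboux_upper k T a b g (fun x => - f x) s.
Proof.
rewrite /darboux_lower /darboux_upper -sumrN; apply: eq_bigr => j _.
by rewrite /inf mulNr image_comp.
Qed.

(** Holds for arbitrary [f], as [inf] is by definition the opposite of the [sup] of
the opposites. *)
Lemma lower_integralN a f :
  lower_integral k T a b g f = - upper_integral k T a b g (fun x => - f x).
Proof.
rewrite /lower_integral /upper_integral /inf opprK image_comp.
by congr sup; apply: eq_imagel => s _; rewrite darboux_lowerN.
Qed.

(** The final point [b] is both the end of the partition and the default value of
[nth], so the tail of a partition of [[a, b]] yields an upper sum with the same
[b] and a new starting point. This is what allows induction on partitions. *)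
Lemma darboux_upper_cons a f x s :
  darboux_upper k T a b g f (x :: s) =
  sup (f @` box_itv k T a x) * (g x - g a) + darboux_upper k T x b g f s.
Proof. by rewrite /darboux_upper/= big_nat_recl. Qed.

(** By induction on the finer partition [x :: s]. If [x] also starts the coarser
one, the first terms agree. Otherwise the coarser one starts with some [y > x];
the induction hypothesis applies on [[x, b]], where [y] still starts a
partition, and it remains to merge two cells, that is, with [M(u,v)] the
supremum of [f] on the cell from [u] to [v]:
[M(a,x) (g x - g a) + M(x,y) (g y - g x) <= M(a,y) (g y - g a)]. *)
Lemma darboux_upper_refine a f s1 s :
  [bounded f x | x in ts_itv T a b] ->
  {in ts_itv T a b &, {homo g : x y / x < y}} ->
  ts_partition T a b s1 -> ts_partition T a b s -> subseq s1 s ->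
  darboux_upper k T a b g f s <= darboux_upper k T a b g f s1.
Proof.
elim: s a s1 => [|x s IH] a s1 bf hg p1 p; first by rewrite subseq0 => /eqP->.
have pts y : y \in a :: x :: s -> ts_itv T a b y by case: p => _; apply.
have aI := pts _ (mem_head _ _).
have xI : ts_itv T a b x by apply: pts; rewrite !inE eqxx orbT.
have px := ts_partition_cons p.
have ax : a < x by case: p => [[/andP[]]].
have IxI : ts_itv T x b `<=` ts_itv T a b by apply: subset_ts_itv => //; exact: ltW.
have bx : [bounded f y | y in ts_itv T x b].
  by move/bounded_onP : bf => [M fM]; apply/bounded_onP; exists M => y /IxI /fM.
have hgx : {in ts_itv T x b &, {homo g : u v / u < v}}.
  by move=> u v; rewrite !inE => /IxI uI /IxI vI; apply: hg; rewrite inE.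
case: s1 p1 => [[[_ /eqP/= ab] _]|y s1 p1].
  have := itv_partition_size_neq0 _ p.1; rewrite ab => /(_ isT).
  by rewrite ltxx.
have py := ts_partition_cons p1.
rewrite [subseq _ _]/=; case: eqVneq => [yx|_] sub.
  subst y; rewrite !darboux_upper_cons lerD2l; exact: IH.
have ys : y \in s by apply: (mem_subseq sub); exact: mem_head.
have xy : x < y by case: px => [[/(order_path_min lt_trans)/allP + _] _]; apply.
have yI : ts_itv T a b y by apply: pts; rewrite !inE ys !orbT.
have p1x : ts_partition T x b (y :: s1).
  case: p1 => -[/= /andP[ay pys] lb] ss; split.
    by split=> //=; rewrite xy.
  move=> z /=; rewrite inE => /predU1P[->|zs].
    by case: px => _; apply; rewrite /= mem_head.
  by case: px => _; apply; rewrite /= inE (mem_subseq sub zs) orbT.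
have := IH x _ bx hgx p1x px sub.
rewrite !darboux_upper_cons.
have gax : 0 <= g x - g a by rewrite subr_ge0 ltW// hg ?inE.
have gxy : 0 <= g y - g x by rewrite subr_ge0 ltW// hg ?inE.
have hsup u v : ts_itv T a b u -> ts_itv T a b v -> a <= u -> u < v -> v <= y ->
    sup (f @` box_itv k T u v) <= sup (f @` box_itv k T a y).
  move=> uI vI au uv vy; have [ne _] := has_sup_box bf uI vI uv.
  have [_ ub] := has_sup_box bf aI yI (lt_trans ax xy).
  apply: ge_sup => // _ [z zb <-]; apply: ub_le_sup => //; exists z => //.
  by apply: subset_box_itv zb => //; [case: uI|case: vI].
have h1 := ler_wpM2r gax (hsup a x aI xI (lexx _) ax (ltW xy)).
have h2 := ler_wpM2r gxy (hsup x y xI yI (ltW ax) xy (lexx _)).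
lra.
Qed.

End upper.

(** * Sublinearity of the upper integral *)

Section sublinear.
Context {R : realType} (T : set R) (k : box_kind) (a b : R) (g : R -> R).
Hypothesis Ta : T a.
Hypothesis Tb : T b.
Hypothesis ab : a < b.
Hypothesis hg : {in ts_itv T a b &, {homo g : x y / x < y}}.

Local Notation P := (ts_partition T a b).
Local Notation U := (darboux_upper k T a b g).
Local Notation upper := (upper_integral k T a b g).
Local Notation bounded f := [bounded f x | x in ts_itv T a b].

Lemma darboux_cell_ge0 s j : P s -> (j < size s)%N ->
  0 <= g (nth b (a :: s) j.+1) - g (nth b (a :: s) j).
Proof.
by move=> Ps /(ts_partition_cell Ps)[xI yI xy]; rewrite subr_ge0 ltW// hg ?inE.
Qed.

(** If [-M <= f], the suprema on the (nonempty) cells are at least [-M], and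
telescoping bounds all the upper sums below by [- M * (g b - g a)]. *)
Lemma has_inf_darboux_upper f : bounded f -> has_inf (U f @` P).
Proof.
move=> bf; split; first by exists (U f [:: b]), [:: b]; first exact: ts_partition1.
have /bounded_onP[M fM] := bf.
exists (- M * (g b - g a)) => _ [s Ps <-].
have -> : g b - g a = \sum_(0 <= j < size s)
    (g (nth b (a :: s) j.+1) - g (nth b (a :: s) j)).
  rewrite (telescope_sumr (fun j => g (nth b (a :: s) j)))//.
  by case: Ps => ps _; rewrite (itv_partition_nth_size _ ps).
rewrite mulr_sumr; apply: ler_sum_nat => j /andP[_ js].
apply: ler_wpM2r; first exact: darboux_cell_ge0.
have [xI yI xy] := ts_partition_cell Ps js.
have [[_ [z zb _]] ub] := has_sup_box k bf xI yI xy.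
apply: (@le_trans _ _ (f z)); last by apply: ub_le_sup => //; exists z.
have : `|f z| <= M; last by rewrite ler_norml => /andP[].
apply: fM; have [/= xI' Tx] := xI; have [/= yI' Ty] := yI.
apply: subset_ts_itv (box_itv_sub Tx Ty xy zb).
- by move: xI'; rewrite in_itv/= => /andP[].
- by move: yI'; rewrite in_itv/= => /andP[].
Qed.

Lemma darboux_upperD (f1 f2 : R -> R) s : bounded f1 -> bounded f2 -> P s ->
  U (fun x => f1 x + f2 x) s <= U f1 s + U f2 s.
Proof.
move=> b1 b2 Ps; rewrite /darboux_upper -big_split/=.
apply: ler_sum_nat => j /andP[_ js]; rewrite -mulrDl.
apply: ler_wpM2r; first exact: darboux_cell_ge0.
have [xI yI xy] := ts_partition_cell Ps js.
have [[_ [z zb _]] ub1] := has_sup_box k b1 xI yI xy.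
have [_ ub2] := has_sup_box k b2 xI yI xy.
apply: ge_sup => [|_ [x xb <-]]; first by exists (f1 z + f2 z), z.
by apply: lerD; apply: ub_le_sup => //; exists x.
Qed.

(** A common refinement gives [upper (f1 + f2) <= U f1 s1 + U f2 s2] for
independent [s1] and [s2], so the two infima can be taken one after the other. *)
Lemma upper_integralD (f1 f2 : R -> R) : bounded f1 -> bounded f2 ->
  upper (fun x => f1 x + f2 x) <= upper f1 + upper f2.
Proof.
move=> b1 b2.
have b12 := bounded_onD b1 b2.
have key s1 s2 : P s1 -> P s2 -> upper (fun x => f1 x + f2 x) <= U f1 s1 + U f2 s2.
  move=> P1 P2; have [s [Ps ss1 ss2]] := ts_partition_refinement ab P1 P2.
  apply: (@le_trans _ _ (U (fun x => f1 x + f2 x) s)).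
    by apply: ge_inf; [case: (has_inf_darboux_upper b12)|exists s].
  apply: le_trans (darboux_upperD b1 b2 Ps) _.
  by apply: lerD; exact: darboux_upper_refine.
have [ne1 _] := has_inf_darboux_upper b1.
have [ne2 _] := has_inf_darboux_upper b2.
rewrite -lerBlDl; apply: (lb_le_inf ne2) => _ [s2 P2 <-].
rewrite lerBlDr -lerBlDl; apply: (lb_le_inf ne1) => _ [s1 P1 <-].
by rewrite lerBlDl addrC; exact: key.
Qed.

(** Equality holds already at the level of the upper sums over each partition. *)
Lemma upper_integralZ (c : R) (f : R -> R) : 0 <= c -> bounded f ->
  upper (fun x => c * f x) = c * upper f.
Proof.
move=> c0 bf; rewrite /upper_integral -infZ//; last exact: has_inf_darboux_upper.
rewrite image_comp; congr inf; apply: eq_imagel => s Ps /=.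
rewrite /darboux_upper mulr_sumr; apply: eq_big_nat => j /andP[_ js].
have [xI yI xy] := ts_partition_cell Ps js.
by rewrite mulrA -supZ ?image_comp//; exact: has_sup_box bf xI yI xy.
Qed.

End sublinear.

(** Integrability is phrased with the upper integral alone, as oddness at [f], so
that only the sublinearity of that functional matters afterwards. *)
Lemma RS_integrableP (R : realType) (T : set R) k (a b : R) (g f : R -> R) :
  RS_integrable k T a b g f <-> [bounded f x | x in ts_itv T a b] /\
  upper_integral k T a b g (fun x => - f x) = - upper_integral k T a b g f.
Proof.
rewrite /RS_integrable lower_integralN.
by split=> -[bf h]; split=> //; [rewrite h opprK|rewrite h opprK].
Qed.

(** * Linearity of the integral *)

Unset Implicit Arguments.
Set Strict Implicit.

Theorem theorem3p5 (R : realType) (T : set R) (a b : R) (k : box_kind)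
    (g f1 f2 : R -> R) (c : R)
    (hT : time_scale T) (ha : T a) (hb : T b) (hab : a < b)
    (hg : {in ts_itv T a b &, {homo g : x y / x < y}})
    (hf1 : RS_class k T a b g f1) (hf2 : RS_class k T a b g f2) :
  (RS_class k T a b g (fun x => c * f1 x) /\
   RS_integral k T a b g (fun x => c * f1 x) = c * RS_integral k T a b g f1) /\
  (RS_class k T a b g (fun x => f1 x + f2 x) /\
   RS_integral k T a b g (fun x => f1 x + f2 x) =
     RS_integral k T a b g f1 + RS_integral k T a b g f2).
Proof.
have /RS_integrableP[b1 N1] := hf1; have /RS_integrableP[b2 N2] := hf2.
rewrite /RS_class /RS_integral /=.
have bN (f : R -> R) : [bounded f x | x in ts_itv T a b] ->
    [bounded - f x | x in ts_itv T a b].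
  by move=> /(bounded_onZ (-1)); under eq_fun do rewrite mulN1r.
have upD (f f' : R -> R) := @upper_integralD _ T k a b g ha hb hab hg f f'.
have upZ (d : R) (f : R -> R) := @upper_integralZ _ T k a b g ha hb hab hg d f.
split.
  have bc := bounded_onZ c b1.
  suff [e1 e2] :
      upper_integral k T a b g (fun x => c * f1 x) = c * upper_integral k T a b g f1 /\
      upper_integral k T a b g (fun x => - (c * f1 x)) =
        - (c * upper_integral k T a b g f1).
    by split=> //; apply/RS_integrableP; rewrite e1 e2.
  (* For [c <= 0], homogeneity is used through [c f = (- c) (- f)]. *)
  have [c0|/ltW c0] := leP 0 c.
    rewrite upZ//; split=> //.
    under eq_fun do rewrite -mulrN.
    by rewrite upZ//; [rewrite N1 mulrN|exact: bN].
  have c0' : 0 <= - c by rewrite oppr_ge0.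
  split.
    under eq_fun do rewrite -mulrNN.
    by rewrite upZ//; [rewrite N1 mulrNN|exact: bN].
  under eq_fun do rewrite -mulNr.
  by rewrite upZ// mulNr.
have b12 := bounded_onD b1 b2.
(* The three subadditivity inequalities squeeze [upper (f1 + f2)] and
   [upper (- (f1 + f2))] to their expected values. *)
have h1 := upD _ _ b1 b2.
have h2 := upD _ _ (bN _ b1) (bN _ b2).
have h3 := upD _ _ b12 (bN _ b12).
have z : upper_integral k T a b g
    (fun x => f1 x + f2 x + - (f1 x + f2 x)) = 0.
  rewrite (_ : (fun _ => _) = (fun x => 0 * f1 x)).
    by rewrite upZ// mul0r.
  by apply/funext => x; rewrite subrr mul0r.
have e : (fun x => - f1 x + - f2 x) = (fun x => - (f1 x + f2 x)).
  by apply/funext => x; rewrite opprD.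
rewrite z in h3; rewrite e N1 N2 in h2.
have e1 : upper_integral k T a b g (fun x => f1 x + f2 x) =
  upper_integral k T a b g f1 + upper_integral k T a b g f2 by lra.
split=> //; apply/RS_integrableP; split=> //; lra.
Qed.
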